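(* Let $R$ be a ring, $(\sigma,\delta)$ a quasi-derivation of $R$, and $M_R$ a right $R$-module. If $M_R$ is $(\sigma,\delta)$-skew Armendariz, then $M_R$ is $(\sigma,\delta)$-skew McCoy.
   Context: Rings are associative with unity; modules are right modules. A quasi-derivation $(\sigma,\delta)$ of a ring $R$ consists of a ring endomorphism $\sigma$ of $R$ and an additive map $\delta\colon R\to R$ with $\delta(ab)=\sigma(a)\delta(b)+\delta(a)b$ for all $a,b\in R$. The Ore extension $R[x;\sigma,\delta]$ consists of polynomials $\sum a_ix^i$ with coefficients on the left and multiplication determined by $xa=\sigma(a)x+\delta(a)$. For $0\le i\le j$, $f_i^j\colon R\to R$ is the sum of all words in $\sigma,\delta$ with $i$ factors $\sigma$ and $j-i$ factors $\delta$, so $x^ja=\sum_{i=0}^jf_i^j(a)x^i$. For a right $R$-module $M$, $M[x;\sigma,\delta]=\{\sum_{i=0}^p m_ix^i\mid p\ge0,\ m_i\in M\}$ is the right $R[x;\sigma,\delta]$-module with obvious addition and action $(mx^j)(ax^{\ell})=\sum_{i=0}^jmf_i^j(a)x^{i+\ell}$. $M_R$ is called $(\sigma,\delta)$-skew Armendariz if whenever $m(x)g(x)=0$ with $m(x)=\sum_{i=0}^pm_ix^i\in M[x;\sigma,\delta]$ and $g(x)=\sum_{j=0}^qb_jx^j\in R[x;\sigma,\delta]$, one has $(m_ix^i)(b_jx^j)=0$ for all $i,j$. $M_R$ is called $(\sigma,\delta)$-skew McCoy if whenever $m(x)g(x)=0$ with $m(x)\in M[x;\sigma,\delta]$ and $g(x)\in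 R[x;\sigma,\delta]\setminus\{0\}$, there exists $a\in R\setminus\{0\}$ with $m(x)a=0$. *)

(* Defs.v *)
From HB Require Import structures.
From mathcomp Require Import all_boot all_algebra finmap.
From mathcomp Require Export monalg.

Set Implicit Arguments.
Unset Strict Implicit.
Unset Printing Implicit Defensive.

Import GRing.Theory.
Local Open Scope ring_scope.

(* Rings are [pzRingType]s, so the zero ring is allowed and nothing is        *)
(* commutative. A right R-module is a left module over the converse ring R^c. *)
Definition rscale (R : pzRingType) (M : lmodType R^c) (m : M) (a : R) : M :=
  (a : R^c) *: m.

Notation "m *r a" := (rscale m a) (at level 40, left associativity).

(* [sigma] preserves 1, and additivity of [delta] is part of its type. *)
Definition quasi_derivation (R : pzRingType)
    (sigma : {rmorphism R -> R}) (delta : {additive R -> R}) : Prop :=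
  forall a b : R, delta (a * b) = sigma a * delta b + delta a * b.

(* A word in sigma, delta is a boolean sequence: true codes sigma, false codes *)
(* delta, and juxtaposition is composition.                                    *)
Definition word_eval (R : pzRingType) (sigma delta : R -> R) (w : seq bool)
    (a : R) : R :=
  foldr (fun s y => if s then sigma y else delta y) a w.

(* f_i^j: distinct words are distinct summands, even if they happen to define *)
(* the same map.                                                              *)
Definition word_sum (R : pzRingType) (sigma delta : R -> R) (i j : nat)
    (a : R) : R :=
  \sum_(w : j.-tuple bool | count_mem true w == i) word_eval sigma delta w a.

(* The additive group of polynomials in x with coefficients in V: finitely    *)
(* supported functions on exponents, with c x^k written << c *g k >> and the  *)
(* coefficient of x^k in m written m@_k. It carries both R[x; sigma, delta]   *)
(* and M[x; sigma, delta]; the twist lies in the action below.                *)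
Notation xpoly V := {malg V[nat]}.

Section SkewAction.

Variables (R : pzRingType) (sigma delta : R -> R) (M : lmodType R^c).

(* The biadditive extension of                                                *)
(*   (m x^j)(a x^l) = \sum_(0 <= i <= j) m f_i^j(a) x^(i + l).                *)
Definition skew_act (m : xpoly M) (g : xpoly R) : xpoly M :=
  \sum_(j <- msupp m) \sum_(l <- msupp g) \sum_(i < j.+1)
    << m@_j *r word_sum sigma delta i j g@_l *g (i + l)%N >>.

Definition skew_Armendariz : Prop :=
  forall (m : xpoly M) (g : xpoly R), skew_act m g = 0 ->
    forall i j : nat, skew_act << m@_i *g i >> << g@_j *g j >> = 0.

Definition skew_McCoy : Prop :=
  forall (m : xpoly M) (g : xpoly R), g != 0 -> skew_act m g = 0 ->
    exists2 a : R, a != 0 & skew_act m << a *g 0%N >> = 0.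

End SkewAction.

Section SkewActionTheory.

Variables (R : pzRingType) (sigma delta : {additive R -> R}).
Variable (M : lmodType R^c).

Implicit Types (m : xpoly M) (g : xpoly R).

Let term (j l : nat) (c : M) (a : R) : xpoly M :=
  \sum_(i < j.+1) << c *r word_sum sigma delta i j a *g (i + l)%N >>.

Lemma word_evalD w : {morph word_eval sigma delta w : a b / a + b}.
Proof. by move=> a b; elim: w => //= -[] w ->; rewrite raddfD. Qed.

Lemma word_sumD i j : {morph word_sum sigma delta i j : a b / a + b}.
Proof.
by move=> a b; rewrite -big_split; apply: eq_bigr => w _; apply: word_evalD.
Qed.

Let termDl j l c d a : term j l (c + d) a = term j l c a + term j l d a.
Proof.
by rewrite -big_split; apply: eq_bigr => i _; rewrite /rscale scalerDr raddfD.
Qed.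

Let termDr j l c a b : term j l c (a + b) = term j l c a + term j l c b.
Proof.
rewrite -big_split; apply: eq_bigr => i _.
by rewrite word_sumD /rscale scalerDl raddfD.
Qed.

Let term0l j l a : term j l 0 a = 0.
Proof. by apply: (addrI (term j l 0 a)); rewrite -termDl !addr0. Qed.

Let term0r j l c : term j l c 0 = 0.
Proof. by apply: (addrI (term j l c 0)); rewrite -termDr !addr0. Qed.

Lemma skew_actEw m g (A B : {fset nat}) :
    (msupp m `<=` A)%fset -> (msupp g `<=` B)%fset ->
  skew_act sigma delta m g =
    \sum_(j <- A) \sum_(l <- B) \sum_(i < j.+1)
      << m@_j *r word_sum sigma delta i j g@_l *g (i + l)%N >>.
Proof.
move=> leA leB; rewrite /skew_act.
rewrite (big_fset_incl _ leA) => [|j _ jNm]; last first.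
  by rewrite mcoeff_outdom // big1 // => l _; apply: term0l.
apply: eq_bigr => j _; rewrite (big_fset_incl _ leB) // => l _ lNg.
by rewrite (mcoeff_outdom lNg); apply: term0r.
Qed.

Lemma skew_actDl g :
  {morph (fun m => skew_act sigma delta m g) : m1 m2 / m1 + m2}.
Proof.
move=> m1 m2; set A := (msupp m1 `|` msupp m2)%fset.
rewrite !(@skew_actEw _ g A (msupp g)) ?fsubsetUl ?fsubsetUr ?msuppD_le //.
rewrite -big_split; apply: eq_bigr => j _; rewrite -big_split.
by apply: eq_bigr => l _; rewrite mcoeffD; apply: termDl.
Qed.

Lemma skew_actDr m : {morph skew_act sigma delta m : g1 g2 / g1 + g2}.
Proof.
move=> g1 g2; set B := (msupp g1 `|` msupp g2)%fset.
rewrite !(@skew_actEw m _ (msupp m) B) ?fsubsetUl ?fsubsetUr ?msuppD_le //.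
rewrite -big_split; apply: eq_bigr => j _; rewrite -big_split.
by apply: eq_bigr => l _; rewrite mcoeffD; apply: termDr.
Qed.

Lemma skew_actUU (c : M) (a : R) (j l : nat) :
  skew_act sigma delta << c *g j >> << a *g l >> =
    \sum_(i < j.+1) << c *r word_sum sigma delta i j a *g (i + l)%N >>.
Proof.
by rewrite (skew_actEw msuppU_le msuppU_le) !big_seq_fset1 !mcoeffUU.
Qed.

End SkewActionTheory.

(* For M = R the action is the multiplication of R[x; sigma, delta]. *)
Lemma skew_act_commute (R : pzRingType) (sigma delta : {additive R -> R})
    (a : R) :
  @skew_act R sigma delta (R^c)^o << (1 : R) *g 1%N >> << a *g 0%N >> =
    << sigma a *g 1%N >> + << delta a *g 0%N >> :> xpoly R.
Proof.
have f1 i : word_sum sigma delta i 1 a =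
    (if i == 1%N then sigma a else 0) + (if i == 0%N then delta a else 0).
  rewrite /word_sum (reindex (fun b : bool => [tuple b])) /=; last first.
    exists (fun w => thead w) => [b _ | w _]; first by [].
    by apply: val_inj; case/tupleP: w => b w; rewrite tuple0.
  by rewrite big_mkcond big_bool /= !addn0 ![_ == i]eq_sym.
rewrite skew_actUU big_ord_recl big_ord1 addrC /rscale !f1 /= addr0 add0r.
by congr (<< _ *g _ >> + << _ *g _ >>); exact: mul1r.
Qed.

(* Main.v *)
Require Import Defs.
From mathcomp Require Import all_boot all_algebra finmap.

Import GRing.Theory.
Local Open Scope ring_scope.

(** The terms of [(c x^j)(a x^l)] have distinct exponents [i + l], so the product vanishes iff every
    [c f_i^j(a)] does, a condition free of [l]. Armendariz gives it for each [m_i] and a nonzero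
    coefficient [a] of [g]; read at [l = 0], it says [m(x) a = 0]. *)

Lemma skew_actUU_eq0 (R : pzRingType) (sigma delta : {additive R -> R})
    (M : lmodType R^c) (c : M) (a : R) (j l : nat) :
  skew_act sigma delta << c *g j >> << a *g l >> = 0 <->
    forall i : 'I_j.+1, c *r word_sum sigma delta i j a = 0.
Proof.
rewrite skew_actUU; split=> [act0 i | coef0]; last first.
  by apply: big1 => i _; rewrite coef0 monalgU0.
(* Shifting by [l] is injective, so only the [i]-th summand reaches this exponent. *)
move/(congr1 (mcoeff (i + l)%N)): act0; rewrite mcoeff0 raddf_sum (bigD1 i) //=.
rewrite mcoeffUU big1 ?addr0 // => k k_neq_i.
by rewrite mcoeffU eqn_add2r val_eqE (negPf k_neq_i) mulr0n.
Qed.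

(* Any nonzero coefficient [a = b_j] of [g] witnesses the McCoy condition: the
   vanishing of [(m_i x^i)(a x^j)] does not depend on [j]. *)
Theorem proposition2p4 (R : pzRingType)
    (sigma : {rmorphism R -> R}) (delta : {additive R -> R})
    (M : lmodType R^c) :
  quasi_derivation sigma delta ->
  skew_Armendariz sigma delta M -> skew_McCoy sigma delta M.
Proof.
move=> _ armM m g g_neq0 mg0.
have [j gj_supp] : exists j, j \in msupp g.
  apply/fset0Pn; apply: contra_neq g_neq0 => supp0.
  by rewrite [g]monalgE supp0 big_seq_fset0.
exists g@_j; first by rewrite mcoeff_neq0.
rewrite (skew_actEw sigma delta (fsubset_refl _) msuppU_le) big1 // => i _.
rewrite big_seq_fset1 big1 // => k _; rewrite mcoeffUU.
(* The hypothesis concerns [x^j], the goal [x^0]; the coefficients agree. *)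
by have /skew_actUU_eq0 -> := armM m g mg0 i j; rewrite monalgU0.
Qed.
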